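(* Let $(X,r)$ be a solution of the YBE with $|X|>1$. If $(X,r)$ is of finite multipermutation level and $r$ is of finite order (as a permutation of $X^2$), then $r$ is of even order.
   Context: A solution of the YBE is a pair $(X,r)$ with $X$ a non-empty set and $r\colon X^2\to X^2$, $r(x,y)=(\lambda_x(y),\rho_y(x))$, a bijective map such that all $\lambda_x,\rho_y$ are bijective and $(r\times\mathrm{id})(\mathrm{id}\times r)(r\times\mathrm{id})=(\mathrm{id}\times r)(r\times\mathrm{id})(\mathrm{id}\times r)$ on $X^3$. Retract and multipermutation level: define $x\sim y$ iff $\lambda_x=\lambda_y$ and $\rho_x=\rho_y$. Then $r$ induces a solution $\overline r(\overline x,\overline y)=(\overline{\lambda_x(y)},\overline{\rho_y(x)})$ of the YBE on $X/{\sim}$, denoted $\mathrm{Ret}(X,r)$. Put $\mathrm{Ret}^0(X,r)=(X,r)$ and $\mathrm{Ret}^n(X,r)=\mathrm{Ret}(\mathrm{Ret}^{n-1}(X,r))$. $(X,r)$ is of finite multipermutation level if some $\mathrm{Ret}^m(X,r)$, $m\ge 0$, has exactly one element. *)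

(* Defs.v *)
From mathcomp Require Import all_boot generic_quotient boolp.

Set Implicit Arguments.
Unset Strict Implicit.
Unset Printing Implicit Defensive.

Local Open Scope quotient_scope.

Definition lam (X : Type) (r : X * X -> X * X) (x y : X) : X := (r (x, y)).1.
Definition rho (X : Type) (r : X * X -> X * X) (y x : X) : X := (r (x, y)).2.

(* [r x id] and [id x r] on X * X * X, which is (X * X) * X. *)
Definition r12 (X : Type) (r : X * X -> X * X) (t : X * X * X) : X * X * X :=
  (r t.1, t.2).
Definition r23 (X : Type) (r : X * X -> X * X) (t : X * X * X) : X * X * X :=
  let q := r (t.1.2, t.2) in (t.1.1, q.1, q.2).

Definition is_solution (X : Type) (r : X * X -> X * X) : Prop :=
  [/\ inhabited X, bijective r,
      forall x, bijective (lam r x),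
      forall y, bijective (rho r y)
    & forall t, r12 r (r23 r (r12 r t)) = r23 r (r12 r (r23 r t))].

Record solution := Solution {
  carrier :> Type;
  rmap : carrier * carrier -> carrier * carrier;
  rmapP : is_solution rmap }.
Arguments rmap : clear implicits.

Section RetractCongruence.
(* Lemmas about a pair of families of permutations satisfying the three
   components of the YBE. These hypotheses are invariant under exchanging
   [l] and [p], so that each lemma has a mirror image. *)
Variables (X : Type) (l p : X -> X -> X).
Hypothesis E1 : forall x y z, l x (l y z) = l (l x y) (l (p y x) z).
Hypothesis E2 : forall x y z,
  p (l (p y x) z) (l x y) = l (p (l y z) x) (p z y).
Hypothesis E3 : forall x y z, p z (p y x) = p (p z y) (p (l y z) x).
Hypothesis lbij : forall x, bijective (l x).
Hypothesis pbij : forall x, bijective (p x).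

Let linj x : injective (l x). Proof. exact: bij_inj. Qed.
Let pinj x : injective (p x). Proof. exact: bij_inj. Qed.
Let lsurj x y : exists z, l x z = y.
Proof. by have [g _ gK] := lbij x; exists (g y). Qed.
Let psurj x y : exists z, p x z = y.
Proof. by have [g _ gK] := pbij x; exists (g y). Qed.

Let Tsurj a : exists e, l e a = e.
Proof.
have [b ba] := psurj a a; exists (l b a).
by have [w aw] := lsurj a a; have := E1 b a w; rewrite ba aw.
Qed.

Lemma congr_fix a b b' : p (l a b) = p (l a b') -> p b a = p b' a.
Proof.
move=> pE; have [z za] := Tsurj a.
have key c : p (l a c) z = l (p (l a c) z) (p c a).
  rewrite -E2 za; congr (p _ z).
  by apply: (@linj z); rewrite E1 za.
by apply: (@linj (p (l a b) z)); rewrite -key pE -key.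
Qed.

Lemma congr_l a b b' : l b = l b' -> p b = p b' ->
  l (l a b) = l (l a b') /\ p (l a b) = p (l a b').
Proof.
move=> lE pE; split; apply: funext => w.
- by have [v <-] := lsurj (p b a) w; rewrite -E1 lE pE -E1.
- by apply: (@pinj (p b a)); rewrite -E3 pE -E3.
Qed.

Lemma congr_lV a b b' :
  l (l a b) = l (l a b') -> p (l a b) = p (l a b') -> l b = l b' /\ p b = p b'.
Proof.
move=> lE pE; have pba := congr_fix pE; split; apply: funext => w.
- by apply: (@linj a); rewrite [LHS]E1 [RHS]E1 lE pba.
- by have [v <-] := psurj a w; rewrite [LHS]E3 [RHS]E3 pE pba.
Qed.

End RetractCongruence.

Section Retract.
Variable S : solution.
Let r := rmap S.

Definition sim_prop (x y : S) : Prop := lam r x = lam r y /\ rho r x = rho r y.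

(* Boolean version of [sim_prop], on the carrier with its classical
   choiceType structure, as required by [{eq_quot _}]. *)
Definition sim : rel {classic S} := fun x y => `[< sim_prop x y >].

Lemma sim_refl : reflexive sim.
Proof. by move=> x; apply/asboolP. Qed.

Lemma sim_sym : symmetric sim.
Proof. by move=> x y; apply/asboolP/asboolP => -[? ?]; split. Qed.

Lemma sim_trans : transitive sim.
Proof.
move=> y x z /asboolP[a b] /asboolP[c d]; apply/asboolP.
by split; [rewrite a c | rewrite b d].
Qed.

Canonical sim_equiv := EquivRel sim sim_refl sim_sym sim_trans.

Definition ret_carrier : Type := {eq_quot sim_equiv}.
Definition ret_pi (x : S) : ret_carrier :=
  \pi_{eq_quot sim_equiv} (x : {classic S}).
Definition ret_repr (c : ret_carrier) : S := repr (c : {eq_quot sim_equiv}).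

(* Defined on representatives; [ret_mapE] is the formula on classes. *)
Definition ret_map (q : ret_carrier * ret_carrier) :
    ret_carrier * ret_carrier :=
  let t := r (ret_repr q.1, ret_repr q.2) in (ret_pi t.1, ret_pi t.2).

Lemma ret_reprK c : ret_pi (ret_repr c) = c.
Proof. exact: reprK. Qed.

Lemma ret_piP (x y : S) : ret_pi x = ret_pi y <-> sim_prop x y.
Proof.
split=> [/eqquotP/asboolP //|xy].
by apply/eqquotP; apply/asboolP.
Qed.

Let l := lam r.
Let p := rho r.

Let lbij x : bijective (l x). Proof. by case: (rmapP S). Qed.
Let pbij x : bijective (p x). Proof. by case: (rmapP S). Qed.

Let ybe x y z :
  (l (l x y) (l (p y x) z), p (l (p y x) z) (l x y), p z (p y x)) =
  (l x (l y z), l (p (l y z) x) (p z y), p (p z y) (p (l y z) x)).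
Proof.
have rE a b : r (a, b) = (l a b, p b a) by rewrite /l /p /lam /rho -surjective_pairing.
have [_ _ _ _ /(_ (x, y, z))] := rmapP S.
by rewrite /r12 /r23 /= -/r; do 3!rewrite ?rE /=.
Qed.

Let E1 x y z : l x (l y z) = l (l x y) (l (p y x) z).
Proof. by case: (ybe x y z). Qed.
Let E2 x y z : p (l (p y x) z) (l x y) = l (p (l y z) x) (p z y).
Proof. by case: (ybe x y z). Qed.
Let E3 x y z : p z (p y x) = p (p z y) (p (l y z) x).
Proof. by case: (ybe x y z). Qed.
Let E1' x y z : p x (p y z) = p (p x y) (p (l y x) z).
Proof. exact: E3. Qed.
Let E2' x y z : l (p (l y x) z) (p x y) = p (l (p y z) x) (l z y).
Proof. by rewrite E2. Qed.
Let E3' x y z : l z (l y x) = l (l z y) (l (p y z) x).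
Proof. exact: E1. Qed.

Lemma ret_mapE (x y : S) :
  ret_map (ret_pi x, ret_pi y) = (ret_pi (lam r x y), ret_pi (rho r y x)).
Proof.
rewrite /ret_map /=.
move: (ret_reprK (ret_pi x)) (ret_reprK (ret_pi y)).
move: (ret_repr (ret_pi x)) (ret_repr (ret_pi y)) => x' y'.
move=> /ret_piP[lx px] /ret_piP[ly py].
rewrite -/(lam r x' y') -/(rho r y' x').
congr (_, _); apply/ret_piP.
- rewrite lx; exact: (congr_l E1 E3 lbij pbij x ly py).
- by rewrite py; have [] := congr_l E1' E3' pbij lbij y px lx.
Qed.

Lemma ret_lamE x y : lam ret_map (ret_pi x) (ret_pi y) = ret_pi (lam r x y).
Proof. by rewrite /lam ret_mapE. Qed.

Lemma ret_rhoE x y : rho ret_map (ret_pi y) (ret_pi x) = ret_pi (rho r y x).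
Proof. by rewrite /rho ret_mapE. Qed.

Let bijP (A B : Type) (f : A -> B) :
  injective f -> (forall b, exists a, f a = b) -> bijective f.
Proof.
by move=> fi /choice[g gK]; exists g => // a; apply: fi; rewrite gK.
Qed.

Lemma ret_is_solution : is_solution ret_map.
Proof.
have [[x0] [ri rK riK] _ _ _] := rmapP S.
have lam_inj (a b b' : S) :
    ret_pi (l a b) = ret_pi (l a b') -> ret_pi b = ret_pi b'.
  by move=> /ret_piP[h1 h2]; apply/ret_piP; apply: congr_lV h1 h2.
have rho_inj (a b b' : S) :
    ret_pi (p a b) = ret_pi (p a b') -> ret_pi b = ret_pi b'.
  move=> /ret_piP[h1 h2]; apply/ret_piP.
  by have [] := congr_lV E1' E2' E3' pbij lbij h2 h1.
split.
- by constructor; exact: ret_pi x0.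
- apply: bijP => [[c d] [c' d']|[c d]].
    rewrite -(ret_reprK c) -(ret_reprK d) -(ret_reprK c') -(ret_reprK d').
    move: (ret_repr c) (ret_repr d) (ret_repr c') (ret_repr d') => x y x' y'.
    rewrite !ret_mapE -/l -/p => -[lE pE].
    have [y1 y1E] : exists b, l x b = l x' y'.
      by have [g _ gK] := lbij x; exists (g (l x' y')).
    rewrite -y1E in lE; have /ret_piP[_ hp] := lE.
    have pyE : p y x = p y1 x by apply: (congr_fix E1 E2 lbij pbij hp).
    have [x1 x1E] : exists b, p y1 b = p y' x'.
      by have [g _ gK] := pbij y1; exists (g (p y' x')).
    rewrite pyE -x1E in pE; have /ret_piP[hl _] := pE.
    have lxE : l x y1 = l x1 y1 by apply: (congr_fix E1' E2' pbij lbij hl).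
    have [-> ->] : (x', y') = (x1, y1).
      apply: (can_inj rK).
      by rewrite [LHS]surjective_pairing [RHS]surjective_pairing; congr (_, _);
        [rewrite -[LHS]/(l x' y') -y1E lxE | rewrite -[LHS]/(p y' x') -x1E].
    by rewrite (lam_inj _ _ _ lE) (rho_inj _ _ _ pE).
  have [[x y] xy] : exists q, r q = (ret_repr c, ret_repr d).
    by exists (ri (ret_repr c, ret_repr d)); rewrite /r riK.
  exists (ret_pi x, ret_pi y).
  by rewrite ret_mapE /lam /rho xy !ret_reprK.
- move=> c; rewrite -(ret_reprK c); move: (ret_repr c) => x.
  apply: bijP => [d d'|d].
    by rewrite -(ret_reprK d) -(ret_reprK d') !ret_lamE => /lam_inj.
  have [g _ gK] := lbij x.
  by exists (ret_pi (g (ret_repr d))); rewrite ret_lamE -/l gK ret_reprK.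
- move=> c; rewrite -(ret_reprK c); move: (ret_repr c) => x.
  apply: bijP => [d d'|d].
    by rewrite -(ret_reprK d) -(ret_reprK d') !ret_rhoE => /rho_inj.
  have [g _ gK] := pbij x.
  by exists (ret_pi (g (ret_repr d))); rewrite ret_rhoE -/p gK ret_reprK.
- move=> [[c d] e].
  rewrite -(ret_reprK c) -(ret_reprK d) -(ret_reprK e).
  move: (ret_repr c) (ret_repr d) (ret_repr e) => x y z.
  have := ret_mapE; move: ret_map => f fE.
  rewrite /r12 /r23 /=; do 3!rewrite ?fE /=.
  by rewrite -/l -/p; case: (ybe x y z) => -> -> ->.
Qed.

Definition ret : solution := Solution ret_is_solution.

End Retract.

Definition ret_iter (n : nat) (S : solution) : solution := iter n ret S.

Definition finite_multipermutation_level (S : solution) : Prop :=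
  exists m, exists x : ret_iter m S, forall y : ret_iter m S, y = x.

Definition has_order (T : Type) (f : T -> T) (n : nat) : Prop :=
  [/\ 0 < n, iter n f =1 id
    & forall m, 0 < m -> iter m f =1 id -> n <= m].

(* Main.v *)
Require Import Defs.
From mathcomp Require Import all_boot.

(** An identity [iter n r =1 id] descends to all retracts, so it suffices to
    look at a solution whose retract is a point.  There [r (x, y) = (l y, p x)]
    for fixed maps [l] and [p], so the first component of an odd iterate of [r]
    at [(x, y)] depends on [y] only, and it can be [x] only if there is a single
    point. *)

Definition singleton (T : Type) : Prop := exists x : T, forall y, y = x.

Lemma ret_mapE_pair {S : solution} (q : S * S) :
  ret_map (ret_pi q.1, ret_pi q.2) =
  (ret_pi (rmap S q).1, ret_pi (rmap S q).2).
Proof. by case: q => x y; exact: ret_mapE. Qed.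

Lemma iter_ret_map {S : solution} n (q : S * S) :
  iter n (@ret_map S) (ret_pi q.1, ret_pi q.2) =
  (ret_pi (iter n (rmap S) q).1, ret_pi (iter n (rmap S) q).2).
Proof. by elim: n => //= n ->; exact: ret_mapE_pair. Qed.

Lemma iter_ret_map_id {S : solution} {n} :
  iter n (rmap S) =1 id -> iter n (rmap (ret S)) =1 id.
Proof.
move=> rn [c d]; rewrite -[c]ret_reprK -[d]ret_reprK.
by rewrite [LHS](iter_ret_map n (ret_repr c, ret_repr d)) rn.
Qed.

(** Each application of [r] exchanges the two coordinates, so [f] and [g] are alternating composites
    of [l] and [p], and the parity of [n] decides which argument each one reads. *)
Lemma iter_swap_shape {X : Type} {l p : X -> X} {r : X * X -> X * X} n :
  (forall x y, r (x, y) = (l y, p x)) ->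
  exists f g, forall x y,
    iter n r (x, y) = if odd n then (f y, g x) else (f x, g y).
Proof.
move=> rE; elim: n => [|n [f [g IHn]]]; first by exists id, id.
exists (l \o g), (p \o f) => x y.
by rewrite iterS IHn oddS; case: (odd n); rewrite rE.
Qed.

Lemma singleton_of_ret {S : solution} {n} :
  odd n -> iter n (rmap S) =1 id -> singleton (ret S) -> singleton S.
Proof.
move=> n_odd rn [c cP]; have [[x0] _ _ _ _] := rmapP S.
have sim0 x : sim_prop x x0 by apply/ret_piP; exact: etrans (cP _) (esym (cP _)).
(* All points are equivalent to [x0], so the index of [lam] and of [rho] can be replaced by [x0]. *)
have rE x y : rmap S (x, y) = (lam (rmap S) x0 y, rho (rmap S) x0 x).
  have [[lamE _] [_ rhoE]] := (sim0 x, sim0 y).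
  by rewrite -lamE -rhoE /lam /rho -surjective_pairing.
have [f [g fg]] := iter_swap_shape n rE.
exists (f x0) => y.
(* The pair [(y, x0)] is fixed, and for odd [n] its first coordinate becomes [f x0]. *)
by have := fg y x0; rewrite rn n_odd => -[].
Qed.

Lemma singleton_of_ret_iter {S : solution} {n m} :
  odd n -> iter n (rmap S) =1 id -> singleton (ret_iter m S) -> singleton S.
Proof.
move=> n_odd; elim: m S => [//|m IHm] S rn.
(* Splitting off the innermost retract lets the induction hypothesis apply to [ret S]. *)
rewrite /ret_iter iterSr => /IHm retS1.
exact: singleton_of_ret n_odd rn (retS1 (iter_ret_map_id rn)).
Qed.

Theorem proposition4p6 (S : solution)
    (card_gt1 : exists x y : S, x <> y)
    (mpl : finite_multipermutation_level S)
    (fin_order : exists n, has_order (rmap S) n) :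
  exists n, has_order (rmap S) n /\ ~~ odd n.
Proof.
have [n ordn] := fin_order; have [_ rn _] := ordn.
exists n; split=> //; apply/negP => n_odd.
have [m Sm1] := mpl.
have [x0 x0P] := singleton_of_ret_iter n_odd rn Sm1.
by have [x [y]] := card_gt1; rewrite (x0P x) (x0P y).
Qed.
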